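(* Let $\mathcal{S}_2$ be the variety of commutative, idempotent groupoids satisfying $x(y(xz))\approx x((yx)z)$. Every finite algebra in $\mathcal{S}_2$ is congruence meet-semidistributive.
   Context: A groupoid is a set with one binary operation, written as juxtaposition; idempotent means $xx\approx x$. An algebra is congruence meet-semidistributive if its congruence lattice satisfies: $\alpha\wedge\beta=\alpha\wedge\gamma$ implies $\alpha\wedge(\beta\vee\gamma)=\alpha\wedge\beta$. *)

(* Defs.v *)
From HB Require Import structures.
From mathcomp Require Import all_boot all_order.

Set Implicit Arguments.
Unset Strict Implicit.
Unset Printing Implicit Defensive.

Import Order.TTheory.
Local Open Scope order_scope.

Definition meet_semidistributive (d : Order.disp_t) (L : latticeType d) : Prop :=
  forall a b c : L, a `&` b = a `&` c -> a `&` (b `|` c) = a `&` b.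

Definition in_S2 (T : Type) (op : T -> T -> T) : Prop :=
  [/\ commutative op, idempotent_op op
    & forall x y z, op x (op y (op x z)) = op x (op (op y x) z)].

Section CongruenceLattice.

Variables (T : finType) (op : T -> T -> T).
Implicit Types R : {set T * T}.

Definition is_congruence R : bool :=
  [&& [forall x, (x, x) \in R],
      [forall x, forall y, ((x, y) \in R) ==> ((y, x) \in R)],
      [forall x, forall y, forall z,
         ((x, y) \in R) && ((y, z) \in R) ==> ((x, z) \in R)]
    & [forall x, forall x', forall y, forall y',
         ((x, x') \in R) && ((y, y') \in R) ==> ((op x y, op x' y') \in R)]].

Lemma is_congruenceP R :
  reflect [/\ forall x, (x, x) \in R,
              forall x y, (x, y) \in R -> (y, x) \in R,
              forall x y z, (x, y) \in R -> (y, z) \in R -> (x, z) \in R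
            & forall x x' y y', (x, x') \in R -> (y, y') \in R ->
                (op x y, op x' y') \in R]
          (is_congruence R).
Proof.
apply: (iffP and4P) => [[/forallP r s t m]|[r s t m]]; split => //.
- by move=> x y; move/forallP/(_ x)/forallP/(_ y)/implyP: s; apply.
- move=> x y z xy yz.
  move/forallP/(_ x)/forallP/(_ y)/forallP/(_ z)/implyP: t; apply.
  exact/andP.
- move=> x x' y y' xx yy.
  move/forallP/(_ x)/forallP/(_ x')/forallP/(_ y)/forallP/(_ y')/implyP: m.
  by apply; apply/andP.
- exact/forallP.
- by apply/forallP=> x; apply/forallP=> y; apply/implyP; apply: s.
- apply/forallP=> x; apply/forallP=> y; apply/forallP=> z.
  by apply/implyP=> /andP[]; apply: t.
- apply/forallP=> x; apply/forallP=> x'; apply/forallP=> y; apply/forallP=> y'.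
  by apply/implyP=> /andP[]; apply: m.
Qed.

Lemma is_congruence_bigcap (P : pred {set T * T}) :
  (forall R, P R -> is_congruence R) -> is_congruence (\bigcap_(R | P R) R).
Proof.
move=> PC; apply/is_congruenceP; split.
- by move=> x; apply/bigcapP=> R /PC/is_congruenceP[].
- move=> x y /bigcapP xy; apply/bigcapP=> R PR.
  by have /is_congruenceP[_ s _ _] := PC R PR; apply/s/xy.
- move=> x y z /bigcapP xy /bigcapP yz; apply/bigcapP=> R PR.
  have /is_congruenceP[_ _ t _] := PC R PR.
  by apply: (t x y z); [apply: xy | apply: yz].
- move=> x x' y y' /bigcapP xx /bigcapP yy; apply/bigcapP=> R PR.
  have /is_congruenceP[_ _ _ m] := PC R PR.
  by apply: m; [apply: xx | apply: yy].
Qed.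

Lemma is_congruenceI R1 R2 :
  is_congruence R1 -> is_congruence R2 -> is_congruence (R1 :&: R2).
Proof.
move=> /is_congruenceP[r1 s1 t1 m1] /is_congruenceP[r2 s2 t2 m2].
apply/is_congruenceP; split.
- by move=> x; rewrite inE r1 r2.
- by move=> x y; rewrite !inE => /andP[/s1-> /s2->].
- move=> x y z; rewrite !inE => /andP[a1 a2] /andP[b1 b2].
  by rewrite (t1 x y z) ?(t2 x y z).
- move=> x x' y y'; rewrite !inE => /andP[a1 a2] /andP[b1 b2].
  by rewrite m1 ?m2.
Qed.

Record congruence := Congruence {
  con_set :> {set T * T};
  con_setP : is_congruence con_set
}.

HB.instance Definition _ := [isSub for con_set].
HB.instance Definition _ := [Finite of congruence by <:].

Implicit Types a b c : congruence.

Definition con_le a b : bool := con_set a \subset con_set b.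

Fact con_le_refl : reflexive con_le.
Proof. by move=> a; apply: subxx. Qed.

Fact con_le_anti : antisymmetric con_le.
Proof. by move=> a b ab; apply/val_inj/eqP; rewrite eqEsubset. Qed.

Fact con_le_trans : transitive con_le.
Proof. by move=> b a c; apply: subset_trans. Qed.

Fact con_display : Order.disp_t. Proof. exact: Order.Disp tt tt. Qed.

HB.instance Definition _ := Order.Le_isPOrder.Build con_display congruence
  con_le_refl con_le_anti con_le_trans.

Definition con_meet a b : congruence :=
  Congruence (is_congruenceI (con_setP a) (con_setP b)).

Definition con_above a b : pred {set T * T} :=
  fun R => [&& is_congruence R, con_set a \subset R & con_set b \subset R].

Fact con_above_congruence a b R : con_above a b R -> is_congruence R.
Proof. by case/and3P. Qed.

                                                   
Definition con_join a b : congruence :=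
  Congruence (is_congruence_bigcap (@con_above_congruence a b)).

Fact con_meetP a b c : (a <= con_meet b c) = (a <= b) && (a <= c).
Proof. exact: subsetI. Qed.

Fact con_joinP a b c : (con_join a b <= c) = (a <= c) && (b <= c).
Proof.
apply/idP/andP => [le_ab|[ac bc]].
- by split; apply: subset_trans le_ab; apply/bigcapsP=> R /and3P[].
- by apply: bigcap_inf; apply/and3P; split=> //; apply: con_setP.
Qed.

HB.instance Definition _ :=
  Order.POrder_MeetJoin_isLattice.Build con_display congruence
    con_meetP con_joinP.

End CongruenceLattice.

Definition congruence_meet_semidistributive (T : finType) (op : T -> T -> T) :
  Prop := meet_semidistributive (congruence op).

(* Main.v *)
Require Import Defs.
From mathcomp Require Import all_boot all_order.

(** Over any algebra, every congruence [b] centralizes every congruence [a]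
modulo [a `&` b], and what centralizes [a] modulo a fixed congruence is closed
under joins.  Hence, if [a `&` b = a `&` c =: d], then [b `|` c] centralizes
[a] modulo [d], and the congruence [a `&` (b `|` c)] is abelian modulo [d].
Meet-semidistributivity thus reduces to the absence of nontrivial abelian
congruences.

The proof uses the term condition for the multiplication itself: for
[(x, y)] in [a] and [(u, v)] in [b `|` c], if [u x] and [u y] are [d]-related
then so are [v x] and [v y] ([con_join_centralizes]).  Since
[b `|` c] is the transitive closure of [b :|: c], this condition is propagated
along chains that alternate between [b] and [c].

Putting [y = x] in the defining identity of S2 gives
[x (x (x z)) = x (x z)].  If [(p, q)] lies in a congruence that is abelian
modulo [d], the outermost left factor [p] of [p (p (p q)) = p (p q)] may be
traded for [p q] and for [p (p q)]; by idempotence and commutativity, this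
gives [p q = p (p q)] modulo [d].  Trading the outermost factor [p] of the
latter for [q] and for [p q] gives [q = p q] modulo [d].  By symmetry
[p = p q], so that [p] and [q] are [d]-related ([abelian_pair_collapses]). *)

Set Implicit Arguments.
Unset Strict Implicit.
Unset Printing Implicit Defensive.

Import Order.TTheory.
Local Open Scope order_scope.

Section Congruences.

Variables (T : finType) (op : T -> T -> T).
Implicit Types (a b c d : congruence op) (x y z u v p q : T).

Lemma con_refl a x : (x, x) \in con_set a.
Proof. by case/is_congruenceP: (con_setP a). Qed.

Lemma con_sym a x y : (x, y) \in con_set a -> (y, x) \in con_set a.
Proof. by case/is_congruenceP: (con_setP a) => _ s _ _; apply: s. Qed.

Lemma con_trans a y x z :
  (x, y) \in con_set a -> (y, z) \in con_set a -> (x, z) \in con_set a.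
Proof. by case/is_congruenceP: (con_setP a) => _ _ t _; apply: t. Qed.

Lemma con_op a x x' y y' : (x, x') \in con_set a -> (y, y') \in con_set a ->
  (op x y, op x' y') \in con_set a.
Proof. by case/is_congruenceP: (con_setP a) => _ _ _; apply. Qed.

Lemma con_opl a z x y :
  (x, y) \in con_set a -> (op x z, op y z) \in con_set a.
Proof. by move=> xy; apply: con_op xy (con_refl a z). Qed.

Lemma con_opr a z x y :
  (x, y) \in con_set a -> (op z x, op z y) \in con_set a.
Proof. exact: con_op (con_refl a z). Qed.

Lemma con_meetE a b x y :
  ((x, y) \in con_set (a `&` b)) =
  ((x, y) \in con_set a) && ((x, y) \in con_set b).
Proof. exact: in_setI. Qed.

Definition con_step b c : rel T :=
  fun x y => ((x, y) \in con_set b) || ((x, y) \in con_set c).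

Definition con_chain b c : {set T * T} :=
  [set xy | connect (con_step b c) xy.1 xy.2].

(** A chain of steps is mapped to a chain of steps by each translation, and a
change of both factors of a product is two successive translations. *)
Lemma con_chain_congruence b c : is_congruence op (con_chain b c).
Proof.
have step_sym x y : con_step b c x y -> con_step b c y x.
  by case/orP=> /con_sym xy; rewrite /con_step xy ?orbT.
have conn_map (f : T -> T) :
    (forall x y, con_step b c x y -> con_step b c (f x) (f y)) ->
    forall x y, connect (con_step b c) x y ->
      connect (con_step b c) (f x) (f y).
  move=> fP x y /connectP[s]; elim: s x => [|z s IH] x /= => [_ ->|].
    exact: connect0.
  case/andP=> /fP/connect1 xz sP def_y.
  exact: connect_trans xz (IH z sP def_y).
apply/is_congruenceP; split.
- by move=> x; rewrite inE connect0.
- have csym : connect_sym (con_step b c).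
    by apply: sym_connect_sym => x y; apply/idP/idP; apply: step_sym.
  by move=> x y; rewrite !inE /= csym.
- by move=> x y z; rewrite !inE /=; apply: connect_trans.
- move=> x x' y y'; rewrite !inE /= => xx' yy'.
  apply: (@connect_trans _ _ (op x' y)).
    apply: (conn_map (op^~ y)) xx' => u v /orP[] /(con_opl y) uv;
    by rewrite /con_step uv ?orbT.
  apply: (conn_map (op x')) yy' => u v /orP[] /(con_opr x') uv;
  by rewrite /con_step uv ?orbT.
Qed.

Lemma con_join_connect b c x y :
  (x, y) \in con_set (b `|` c) -> connect (con_step b c) x y.
Proof.
move/bigcapP/(_ (con_chain b c)); rewrite inE; apply.
apply/and3P; split; first exact: con_chain_congruence.
- by apply/subsetP=> -[u v] uv; rewrite inE connect1 // /con_step uv.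
- by apply/subsetP=> -[u v] uv; rewrite inE connect1 // /con_step uv orbT.
Qed.

(** The pair [(v x, v y)] is in [a] because [(x, y)] is, and in [b] because
[v x], [u x], [u y], [v y] are successively [b]-related. *)
Lemma con_meet_centralizes a b u v x y :
  (x, y) \in con_set a -> (u, v) \in con_set b ->
  (op u x, op u y) \in con_set (a `&` b) ->
  (op v x, op v y) \in con_set (a `&` b).
Proof.
move=> xy uv; rewrite !con_meetE (con_opr v xy) => /andP[_ uxuy].
apply: con_trans (con_opl x (con_sym uv)) _.
exact: con_trans uxuy (con_opl y uv).
Qed.

Lemma con_join_centralizes a b c u v x y : a `&` b = a `&` c ->
  (x, y) \in con_set a -> (u, v) \in con_set (b `|` c) ->
  (op u x, op u y) \in con_set (a `&` b) ->
  (op v x, op v y) \in con_set (a `&` b).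
Proof.
move=> eq_bc xy /con_join_connect/connectP[s]; elim: s u => [|w s IH] u.
  by move=> _ ->.
case/andP=> uw sP def_v uxuy; apply: (IH w) => //.
case/orP: uw => uw; first exact: con_meet_centralizes xy uw uxuy.
by rewrite eq_bc in uxuy *; apply: con_meet_centralizes xy uw uxuy.
Qed.

(** The hypothesis [centr] says that the congruence [a] is abelian modulo [d],
as far as the multiplication can tell. *)
Lemma abelian_pair_collapses a d p q :
    commutative op -> idempotent_op op ->
    (forall x y, op x (op x (op x y)) = op x (op x y)) ->
    (forall u v x y, (u, v) \in con_set a -> (x, y) \in con_set a ->
       (op u x, op u y) \in con_set d -> (op v x, op v y) \in con_set d) ->
  (p, q) \in con_set a -> (p, q) \in con_set d.
Proof.
move=> opC opI op3 centr pq.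
have collapse x y : (x, y) \in con_set a -> (y, op x y) \in con_set d.
  move=> xy; set s := op x y; set t := op x s.
  have xs : (x, s) \in con_set a by rewrite -[x in (x, _)]opI con_opr.
  have xt : (x, t) \in con_set a by rewrite -[x in (x, _)]opI con_opr.
  have ys : (y, s) \in con_set a.
    exact: con_trans (con_sym xy) xs.
  have st : (s, t) \in con_set a by apply: con_trans (con_sym xs) xt.
  have xsxt : (op x s, op x t) \in con_set d.
    by rewrite /t /s op3 con_refl.
  have s_st : (s, op s t) \in con_set d.
    by have := centr _ _ _ _ xs st xsxt; rewrite opI.
  have st_t : (op s t, t) \in con_set d.
    by have := centr _ _ _ _ xt st xsxt; rewrite opI opC.
  have xyxs : (op x y, op x s) \in con_set d by apply: con_trans s_st st_t.
  have y_ys : (y, op y s) \in con_set d.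
    by have := centr _ _ _ _ xy ys xyxs; rewrite opI.
  have ys_s : (op y s, s) \in con_set d.
    by have := centr _ _ _ _ xs ys xyxs; rewrite opI opC.
  exact: con_trans y_ys ys_s.
apply: (con_trans (y := op q p)); first exact/collapse/con_sym.
by rewrite opC; apply/con_sym/collapse.
Qed.

End Congruences.

Theorem theorem5p24 (T : finType) (op : T -> T -> T) (hS2 : in_S2 op) :
  congruence_meet_semidistributive op.
Proof.
case: hS2 => opC opI opS2 a b c eq_bc.
have op3 x y : op x (op x (op x y)) = op x (op x y) by rewrite opS2 opI.
apply/le_anti/andP; split; last by rewrite leI2 // leUl.
apply/subsetP=> -[p q] pq.
apply: (abelian_pair_collapses opC opI op3 _ pq) => u v x y.
rewrite [in X in X -> _]con_meetE => /andP[_ uv].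
rewrite [in X in X -> _]con_meetE => /andP[xy _].
exact: (con_join_centralizes eq_bc xy uv).
Qed.
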